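(* Let $\mathbb K$ be an arbitrary field and let $d\geqslant 2$ be an integer. Then $HE(\mathbb K^d)=\lfloor 3d/2\rfloor$, where $HE(\mathbb K^d)$ denotes the minimal positive integer $k$ with the following property: for every finite family $\mathcal A$ of linear operators $\mathbb K^d\to\mathbb K^d$, if any $k$ or fewer elements of $\mathcal A$ have a common eigenvector, then there is a common eigenvector for all operators in the family $\mathcal A$.
   Context: An eigenvector of a linear operator $A:\mathbb K^d\to\mathbb K^d$ is a nonzero vector $\mathbf v\in\mathbb K^d$ such that $A\mathbf v=\lambda\mathbf v$ for some $\lambda\in\mathbb K$. A common eigenvector of several operators is a nonzero vector that is an eigenvector of each of them; the corresponding eigenvalues may differ from operator to operator. *)

(* Defs.v *)
From HB Require Import structures.
From mathcomp Require Import all_boot all_order all_algebra.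

Set Implicit Arguments.
Unset Strict Implicit.
Unset Printing Implicit Defensive.

Import GRing.Theory.
Local Open Scope ring_scope.

Definition eigenvector (K : fieldType) (vT : vectType K) (f : 'End(vT))
    (v : vT) : Prop :=
  v != 0 /\ exists a : K, f v = a *: v.

(* The condition v != 0 is not redundant: it matters when J is empty. *)
Definition common_eigenvector (K : fieldType) (vT : vectType K) (I : finType)
    (A : I -> 'End(vT)) (J : {set I}) (v : vT) : Prop :=
  v != 0 /\ forall i : I, i \in J -> eigenvector (A i) v.

(* Finite families are indexed, so an operator may occur several times; J then
   ranges over the subfamilies with at most k members. *)
Definition helly_eigenvector (K : fieldType) (vT : vectType K) (k : nat)
    : Prop :=
  forall (I : finType) (A : I -> 'End(vT)),
    (forall J : {set I}, (#|J| <= k)%N ->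
       exists v : vT, common_eigenvector A J v) ->
    exists v : vT, common_eigenvector A [set: I] v.

(* HE is a relation: the existence of a least positive k is part of the claim
   HE vT m. *)
Definition HE (K : fieldType) (vT : vectType K) (m : nat) : Prop :=
  [/\ (0 < m)%N, helly_eigenvector vT m
    & forall k : nat, (0 < k)%N -> helly_eigenvector vT k -> (m <= k)%N].

(* Main.v *)
(* Upper bound: suppose v_i is a common eigenvector of all operators but A_i.
   On a circuit X of the v_i every A_j with j outside X is scalar. If the span
   of X met the span of the remaining v_i, a common vector p supported on as few
   elements outside X as possible would be a common eigenvector of the whole
   family. Otherwise circuits split off as direct summands; a circuit has at
   least three elements and rank one less than its size, so at most 3d/2
   operators can occur.
   Lower bound: in each plane spanned by e_{2b}, e_{2b+1}, three rank one
   operators have pairwise, but not all together, a common eigenvector among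
   e_{2b}, e_{2b+1}, e_{2b} + e_{2b+1}; for d odd one more operator excludes the
   last basis vector. *)
Require Import Defs.
From HB Require Import structures.
From mathcomp Require Import all_boot all_order all_algebra.
From mathcomp Require Import zify.

Set Implicit Arguments.
Unset Strict Implicit.
Unset Printing Implicit Defensive.

Import GRing.Theory.
Local Open Scope ring_scope.

(** * Sums of the lines spanned by an indexed family of vectors *)

Section LineSums.

Variables (K : fieldType) (vT : vectType K) (I : finType) (v : I -> vT).
Implicit Types (X Y : {set I}) (f : 'End(vT)).

Definition line_sum Y : {vspace vT} := (\sum_(i in Y) <[v i]>)%VS.

(** Directness of the sum of lines agrees with linear independence when no [v i] vanishes; a zero
    vector spans a zero line, which directness ignores. *)
Definition independent Y : bool := directv (\sum_(i in Y) <[v i]>).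

Lemma line_sum0 : line_sum set0 = 0%VS.
Proof. by rewrite /line_sum big_set0. Qed.

Lemma line_sumD1 x Y : x \in Y -> line_sum Y = (<[v x]> + line_sum (Y :\ x))%VS.
Proof. exact: big_setD1. Qed.

Lemma line_sumD X Y : X \subset Y ->
  line_sum Y = (line_sum X + line_sum (Y :\: X))%VS.
Proof. by move=> sXY; rewrite /line_sum (big_setID X) /= (setIidPr sXY). Qed.

Lemma line_sumS X Y : X \subset Y -> (line_sum X <= line_sum Y)%VS.
Proof. by move=> sXY; rewrite (line_sumD sXY) addvSl. Qed.

Lemma independent0 : independent set0.
Proof. by apply/directv_sumP => i; rewrite inE. Qed.

Lemma independentD1 x Y : v x != 0 -> x \in Y ->
  independent Y = independent (Y :\ x) && (v x \notin line_sum (Y :\ x)).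
Proof.
move=> vx0 Yx; rewrite /independent !directvE /= !(big_setD1 x Yx) /=.
rewrite -directvE directv_addE directv_trivial /= directvE /=.
congr (_ && _); apply/eqP/idP => [cap0 | vxN].
  apply: contra vx0 => vxW; rewrite -memv0 -cap0 memv_cap vxW memv_line //.
apply/eqP; rewrite -subv0; apply/subvP => w; rewrite memv_cap memv0.
case/andP=> /vlineP[c ->]; have [-> | c0] := eqVneq c 0; first by rewrite scale0r.
by rewrite rpredZeq (negPf c0) (negPf vxN).
Qed.

Lemma dim_independent Y : {in Y, forall i, v i != 0} -> independent Y ->
  \dim (line_sum Y) = #|Y|.
Proof.
move=> v0 /directvP /= ->; rewrite -sum1_card; apply: eq_bigr => i Yi.
by rewrite dim_vline v0.
Qed.

(** On each line [f] acts by a scalar, which is [a] on the line of [v x], so this component cancels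
    in the difference. *)
Lemma line_sum_shrink f a x Y w : x \in Y -> f (v x) = a *: v x ->
    {in Y, forall i, f (v i) \in <[v i]>%VS} ->
  w \in line_sum Y -> f w - a *: w \in line_sum (Y :\ x).
Proof.
move=> Yx fvx fv /memv_sumP[u uP ->]; rewrite linear_sum scaler_sumr /= -sumrB.
rewrite (big_setD1 x) //=.
have /vlineP[c ->] := uP x Yx; rewrite linearZ /= fvx !scalerA mulrC subrr add0r.
apply: memv_sumr => i /setD1P[_ Yi]; have /vlineP[b ->] := uP i Yi.
by rewrite linearZ rpredB ?rpredZ ?fv ?memv_line.
Qed.

Lemma line_sum_stable f Y w : {in Y, forall i, f (v i) \in <[v i]>%VS} ->
  w \in line_sum Y -> f w \in line_sum Y.
Proof.
move=> fv /memv_sumP[u uP ->]; rewrite linear_sum; apply: memv_sumr => i Yi.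
by have /vlineP[b ->] := uP i Yi; rewrite linearZ memvZ ?fv.
Qed.

Lemma line_sum_eigen f a Y w : {in Y, forall i, f (v i) = a *: v i} ->
  w \in line_sum Y -> f w = a *: w.
Proof.
move=> fv /memv_sumP[u uP ->]; rewrite linear_sum scaler_sumr; apply: eq_bigr => i Yi.
by have /vlineP[b ->] := uP i Yi; rewrite linearZ /= fv // !scalerA mulrC.
Qed.

(** * Circuits in the sense of matroid theory *)

Definition circuit X : bool := minset [pred Y | ~~ independent Y] X.

Section Circuit.

Variable X : {set I}.
Hypotheses (cX : circuit X) (vX : {in X, forall i, v i != 0}).

Lemma circuitD1_independent x : x \in X -> independent (X :\ x).
Proof.
move=> Xx; apply: contraLR (Xx) => /(minsetinf cX)/(_ (subD1set X x)) <-.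
by rewrite !inE eqxx.
Qed.

Lemma circuit_mem x : x \in X -> v x \in line_sum (X :\ x).
Proof.
move=> Xx; have := minsetp cX; rewrite /= (independentD1 (vX Xx) Xx).
by rewrite circuitD1_independent //= negbK.
Qed.

Lemma circuit_line_sumD1 x : x \in X -> line_sum (X :\ x) = line_sum X.
Proof.
by move=> Xx; rewrite (line_sumD1 Xx); apply/esym/addv_idPr; rewrite -memvE circuit_mem.
Qed.

Lemma circuit_notin x y : x \in X -> y \in X -> x != y ->
  v x \notin line_sum (X :\ x :\ y).
Proof.
move=> Xx Xy xy; have := circuitD1_independent Xy.
rewrite (@independentD1 x) ?vX ?inE ?xy //.
by rewrite !setDDl setUC => /andP[].
Qed.

Lemma dim_circuit : (\dim (line_sum X)).+1 = #|X|.
Proof.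
have [X0 | [x Xx]] := set_0Vmem X.
  by have := minsetp cX; rewrite X0 /= independent0.
rewrite (cardsD1 x) Xx -(circuit_line_sumD1 Xx) dim_independent //.
  by move=> i /setD1P[_]; apply: vX.
exact: circuitD1_independent.
Qed.

(** If [v x] and [v y] had distinct eigenvalues, applying [f - a] to the expression of [v x] in the
    other vectors of the circuit would eliminate [v y] and give a shorter dependence, against
    minimality. *)
Lemma circuit_scalar f : {in X, forall i, f (v i) \in <[v i]>%VS} ->
  exists a, {in line_sum X, forall w, f w = a *: w}.
Proof.
move=> fv; have [X0 | [y Xy]] := set_0Vmem X.
  by have := minsetp cX; rewrite X0 /= independent0.
have /vlineP[a fy] := fv y Xy; exists a => w; apply: line_sum_eigen => x Xx.
have [-> // | xy] := eqVneq x y.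
have /vlineP[b fx] := fv x Xx; rewrite fx; congr (_ *: _).
apply/eqP; rewrite -subr_eq0; apply: contraNT (circuit_notin Xx Xy xy) => ab.
have : f (v x) - a *: v x \in line_sum (X :\ x :\ y).
  apply: line_sum_shrink fy _ (circuit_mem Xx); first by rewrite !inE eq_sym xy.
  by move=> i /setD1P[_]; apply: fv.
by rewrite fx -scalerBl rpredZeq (negPf ab).
Qed.

End Circuit.

End LineSums.

(** * Upper bound: families with vectors missed by one operator each *)

Section UpperBound.

Variables (K : fieldType) (vT : vectType K) (I : finType).
Variables (A : I -> 'End(vT)) (J : {set I}) (v : I -> vT).
Hypothesis vP : {in J, forall i, Defs.common_eigenvector A (J :\ i) (v i)}.

Let v_neq0 i : i \in J -> v i != 0.
Proof. by case/vP. Qed.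

Let v_eigen i j : i \in J -> j \in J -> i != j -> A j (v i) \in <[v i]>%VS.
Proof.
move=> Ji Jj ij; have [_ /(_ j)[]] := vP Ji; first by rewrite !inE eq_sym ij.
by move=> _ /vlineP.
Qed.

(* Choosing S minimal outside the circuit X such that its span meets that of X,
   a vector p in both spans is a common eigenvector: for j in X the span of X
   is also that of X :\ j, hence A_j-stable, so subtracting from A_j p a
   multiple of p that removes one element of S gives a vector of the span of X,
   which must vanish. *)
Lemma circuit_meet_common_eigenvector (X : {set I}) :
    circuit v X -> X \subset J ->
    (line_sum v X :&: line_sum v (J :\: X) != 0)%VS ->
  exists p, Defs.common_eigenvector A J p.
Proof.
move=> cX sXJ XS0.
have vX : {in X, forall i, v i != 0} by move=> i /(subsetP sXJ)/v_neq0.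
have [S minS sS] := minset_exists
  (P := [pred S : {set I} | line_sum v X :&: line_sum v S != 0]%VS) XS0.
have /= XS := minsetp minS.
pose p := vpick (line_sum v X :&: line_sum v S)%VS.
have p0 : p != 0 by rewrite vpick0.
have /andP[pX pS] : (p \in line_sum v X) && (p \in line_sum v S).
  by rewrite -memv_cap memv_pick.
exists p; split=> // j Jj; split=> //.
case Xj: (j \in X); last first.
  have [|a fa] := @circuit_scalar _ _ _ _ _ cX vX (A j); last by exists a; apply: fa.
  move=> i Xi; apply: v_eigen => //; first exact: (subsetP sXJ).
  by apply: contraFneq Xj => <-.
have [S0 | [s Ss]] := set_0Vmem S.
  by move: XS; rewrite S0 line_sum0 capv0 eqxx.
have eS : {in S, forall i, A j (v i) \in <[v i]>%VS}.
  move=> i /(subsetP sS)/setDP[Ji Xi]; apply: v_eigen => //.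
  by apply: contraNneq Xi => ->.
have /vlineP[a fs] := eS s Ss; exists a; apply/eqP; rewrite -subr_eq0.
have qS := line_sum_shrink Ss fs eS pS.
have qX : A j p - a *: p \in line_sum v X.
  rewrite rpredB ?rpredZ // -(circuit_line_sumD1 cX vX Xj).
  apply: line_sum_stable; last by rewrite circuit_line_sumD1.
  by move=> i /setD1P[ij /(subsetP sXJ) Ji]; apply: v_eigen.
rewrite -memv0; have [<- | XSs] := eqVneq (line_sum v X :&: line_sum v (S :\ s))%VS 0%VS.
  by rewrite memv_cap qX qS.
have /setP/(_ s) := minsetinf minS XSs (subD1set S s).
by rewrite !inE eqxx Ss.
Qed.

(** A circuit with at most two elements consists of two parallel vectors [v x] and [v y]; the only
    operator not controlled by [v x] is [A x], and [v y] takes care of it. *)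
Lemma card_circuit_gt2 (X : {set I}) : circuit v X -> X \subset J ->
  (exists p, Defs.common_eigenvector A J p) \/ (2 < #|X|)%N.
Proof.
move=> cX sXJ; have [|leX2] := ltnP 2 #|X|; [by right | left].
have vX : {in X, forall i, v i != 0} by move=> i /(subsetP sXJ)/v_neq0.
have [X0 | [x Xx]] := set_0Vmem X.
  by have := minsetp cX; rewrite X0 /= independent0.
have Jx := subsetP sXJ x Xx; have := circuit_mem cX vX Xx.
have [X0 | [y Xy]] := set_0Vmem (X :\ x).
  by rewrite X0 line_sum0 memv0 (negPf (v_neq0 Jx)).
have -> : X :\ x = [set y].
  apply/esym/eqP; rewrite eqEcard sub1set Xy cards1.
  by move: leX2; rewrite (cardsD1 x) Xx.
rewrite /line_sum big_set1 => /vlineP[c vx].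
have{Xy} /setD1P[yx /(subsetP sXJ) Jy] := Xy.
exists (v x); split=> [|j Jj]; first exact: v_neq0.
split; first exact: v_neq0.
have [<- | xj] := eqVneq x j; last by apply/vlineP/v_eigen.
have /vlineP[b fy] := v_eigen Jy Jx yx.
by exists b; rewrite vx linearZ /= fy !scalerA mulrC.
Qed.

(** Strong induction on [#|Y|]: removing a circuit of size c lowers the cardinality by c and the
    dimension by c - 1, and 2c <= 3(c - 1) as c >= 3. *)
Lemma common_eigenvector_or_card_le (Y : {set I}) : Y \subset J ->
  (exists p, Defs.common_eigenvector A J p) \/
    (2 * #|Y| <= 3 * \dim (line_sum v Y))%N.
Proof.
have [n] := ubnP #|Y|; elim: n Y => // n IHn Y leYn sYJ.
have [indY | depY] := boolP (independent v Y).
  right; rewrite dim_independent ?leq_mul2r ?orbT //.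
  by move=> i /(subsetP sYJ)/v_neq0.
have [X cX sXY] := minset_exists (P := [pred Y | ~~ independent v Y]) depY.
have sXJ := subset_trans sXY sYJ.
have [|X3] := card_circuit_gt2 cX sXJ; first by left.
have sDJ : Y :\: X \subset J := subset_trans (subsetDl Y X) sYJ.
have cardY : #|Y| = (#|X| + #|Y :\: X|)%N.
  by rewrite -(cardsID X Y) (setIidPr sXY).
have [||leD] := IHn (Y :\: X) _ sDJ; [by lia | by left |].
have [cap0 | capN0] := eqVneq (line_sum v X :&: line_sum v (J :\: X))%VS 0%VS; last first.
  by left; apply: circuit_meet_common_eigenvector capN0.
right; rewrite (line_sumD v sXY) dimv_disjoint_sum.
  have := dim_circuit cX (fun i Xi => v_neq0 (subsetP sXJ i Xi)); lia.
by apply/eqP; rewrite -subv0 -cap0 capvS ?line_sumS ?setSD.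
Qed.

End UpperBound.

Lemma helly_eigenvector_dim (K : fieldType) (vT : vectType K) :
  helly_eigenvector vT ((3 * dim vT) %/ 2).
Proof.
move=> I A smallP.
(* Generalizing to all subfamilies lets the induction on size supply the vectors [v i] for
   [J :\ i]. *)
suff all n (J : {set I}) : (#|J| <= n)%N -> exists p, Defs.common_eigenvector A J p.
  exact: all (leqnn _).
elim: n J => [|n IHn] J leJn; first by apply: smallP; lia.
have [/smallP // | gtJ] := leqP #|J| ((3 * dim vT) %/ 2).
have ex i : i \in J -> exists p, Defs.common_eigenvector A (J :\ i) p.
  by move=> Ji; apply: IHn; have := cardsD1 i J; rewrite Ji; lia.
have [v vP] : exists v : I -> vT, {in J, forall i, Defs.common_eigenvector A (J :\ i) (v i)}.
  (* Finite choice by induction on a list; the value 0 outside the list is a dummy. *)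
  have choice (s : seq I) : {subset s <= J} ->
    exists v : I -> vT, {in s, forall i, Defs.common_eigenvector A (J :\ i) (v i)}.
    elim: s => [|x s IHs] sJ; first by exists (fun=> 0).
    have [v vP] := IHs (fun i si => sJ i (mem_behead (s := x :: s) si)).
    have [p pP] := ex x (sJ x (mem_head x s)).
    exists (fun i => if i == x then p else v i) => i; rewrite inE.
    by have [-> | _ /vP] := eqVneq i x.
  have [|v vP] := choice (enum J); first by move=> i; rewrite mem_enum.
  by exists v => i Ji; apply: vP; rewrite mem_enum.
have [//|] := common_eigenvector_or_card_le vP (subxx J).
have := dimvS (subvf (line_sum v J)); rewrite dimvf; lia.
Qed.

(** * Lower bound: an extremal family of rank one operators *)

Section LowerBound.

Variables (K : fieldType) (d : nat).
Hypothesis hd : (2 <= d)%N.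
Implicit Types u w : 'cV[K]_d.

Definition rank1_op (k : 'I_d) (u : 'cV[K]_d) : 'End('cV[K]_d) :=
  linfun (mulmx (u *m delta_mx 0 k)).

Lemma rank1_opE k u w : rank1_op k u w = w k 0 *: u.
Proof.
rewrite lfunE /= -mulmxA -rowE [row k w]mx11_scalar mul_mx_scalar.
by rewrite mxE.
Qed.

Lemma rank1_op_eigenvector k u w :
  w != 0 -> w k 0 = 0 \/ w = u -> Defs.eigenvector (rank1_op k u) w.
Proof.
move=> w0 wku; split=> //; case: wku => [wk0 | ->].
  by exists 0; rewrite rank1_opE wk0 !scale0r.
by exists (u k 0); rewrite rank1_opE.
Qed.

Lemma eigenvector_rank1_op k u w : u k 0 = 1 -> w k 0 != 0 ->
  Defs.eigenvector (rank1_op k u) w -> w = w k 0 *: u.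
Proof.
move=> uk wk [_ [a]]; rewrite rank1_opE => wE.
have /matrixP/(_ k 0) := wE; rewrite !mxE uk mulr1 -{1}[w k 0]mul1r.
by move/(mulIf wk) => a1; rewrite wE -a1 scale1r.
Qed.

Let even_subproof (b : 'I_d./2) : (b.*2 < d)%N.
Proof. by have := ltn_ord b; lia. Qed.

Let odd_subproof (b : 'I_d./2) : (b.*2.+1 < d)%N.
Proof. by have := ltn_ord b; lia. Qed.

Definition even_ord b := Ordinal (even_subproof b).
Definition odd_ord b := Ordinal (odd_subproof b).

(* Coordinates are paired as {2b, 2b + 1}; when d is odd the last one is paired
   with 0. *)
Definition partner (k : nat) : nat :=
  if odd k then k.-1 else if (k.+1 < d)%N then k.+1 else 0%N.

Let partner_subproof (k : 'I_d) : (partner k < d)%N.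
Proof. by have := ltn_ord k; rewrite /partner; case: ifP => _; [|case: ifP]; lia. Qed.

Definition partner_ord k := Ordinal (partner_subproof k).

Definition unit_cV (k : 'I_d) : 'cV[K]_d := delta_mx k 0.

Lemma unit_cVE k l : unit_cV k l 0 = (l == k)%:R.
Proof. by rewrite mxE eqxx andbT. Qed.

(** The index type has d + d./2 elements, which is the bound (3 * d) %/ 2. *)
Definition extremal_op (i : 'I_d + 'I_d./2) : 'End('cV[K]_d) :=
  match i with
  | inl k => rank1_op k (unit_cV k + unit_cV (partner_ord k))
  | inr b => rank1_op (even_ord b) (unit_cV (even_ord b))
  end.

(** The witness for the family with operator [i] removed. *)
Definition extremal_vec (i : 'I_d + 'I_d./2) : 'cV[K]_d :=
  match i with
  | inl k => unit_cV k
  | inr b => unit_cV (even_ord b) + unit_cV (odd_ord b)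
  end.

Lemma partner_neq k : (k == partner_ord k) = false.
Proof.
apply/eqP => /(congr1 val) /=; rewrite /partner.
by case: ifP => [|_]; [|case: ifP]; have := ltn_ord k; lia.
Qed.

Lemma partner_even b : partner_ord (even_ord b) = odd_ord b.
Proof. by apply: val_inj; rewrite /= /partner odd_double odd_subproof. Qed.

Lemma partner_odd b : partner_ord (odd_ord b) = even_ord b.
Proof. by apply: val_inj; rewrite /= /partner /= odd_double. Qed.

Lemma even_odd_neq b b' : (even_ord b == odd_ord b') = false.
Proof. by apply/eqP => /(congr1 val) /=; lia. Qed.

Lemma extremal_vec_neq0 i : extremal_vec i != 0.
Proof.
case: i => [k | b]; apply/eqP => /matrixP.
  by move/(_ k 0)/eqP; rewrite /= unit_cVE mxE eqxx oner_eq0.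
move/(_ (even_ord b) 0)/eqP.
by rewrite /= !mxE /= !eqxx andbT even_odd_neq addr0 oner_eq0.
Qed.

Lemma extremal_vecP i j : i != j ->
  Defs.eigenvector (extremal_op j) (extremal_vec i).
Proof.
move=> ij; have v0 := extremal_vec_neq0 i.
case: j ij => [l | b'] /=; case: i v0 => [k | b] v0 ij;
  apply: rank1_op_eigenvector => //=.
- left; rewrite unit_cVE; case: eqVneq => // lk.
  by rewrite lk eqxx in ij.
- rewrite mxE !unit_cVE.
  have [-> | lb] := eqVneq l (even_ord b); first by right; rewrite partner_even.
  have [-> | lb'] := eqVneq l (odd_ord b); first by right; rewrite partner_odd addrC.
  by left; rewrite addr0.
- rewrite unit_cVE; have [-> | _] := eqVneq; [by right | by left].
- left; rewrite mxE !unit_cVE even_odd_neq addr0; case: eqVneq => // /(congr1 val) /= bb.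
  by case/eqP: ij; congr inr; apply: val_inj => /=; lia.
Qed.

(** A nonzero coordinate must equal that of its partner, by the [inl] operators, while the [inr]
    operators force the even coordinates of the planes to vanish. *)
Lemma extremal_op_no_common w : ~ Defs.common_eigenvector extremal_op setT w.
Proof.
move=> [w0 wP]; have {}wP i := wP i (in_setT i).
have w_partner k : w k 0 != 0 -> w (partner_ord k) 0 = w k 0.
  move=> wk0; rewrite {1}(eigenvector_rank1_op _ wk0 (wP (inl k))).
    by rewrite !mxE !eqxx /= eq_sym partner_neq add0r mulr1.
  by rewrite mxE !unit_cVE eqxx partner_neq addr0.
have w_even b : w (even_ord b) 0 = 0.
  apply: contraTeq isT => wb0; have := w_partner _ wb0.
  rewrite partner_even {1}(eigenvector_rank1_op _ wb0 (wP (inr b))).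
    by rewrite !mxE eq_sym even_odd_neq /= mulr0 => /esym/eqP; rewrite (negPf wb0).
  by rewrite unit_cVE eqxx.
case/eqP: w0; apply/matrixP => k j; rewrite ord1 mxE; apply: contraTeq isT => wk0.
(* It remains to see that every coordinate is the even one of some plane or is paired with such a
   one. *)
suff [b [kb | kb]] : exists b, k = even_ord b \/ partner_ord k = even_ord b.
- by rewrite kb w_even eqxx in wk0.
- by have /esym/eqP := w_partner k wk0; rewrite kb w_even (negPf wk0).
have kd := ltn_ord k; case: (boolP (odd k)) => kodd.
  have kb : (k./2 < d./2)%N by lia.
  exists (Ordinal kb); right; apply: val_inj; rewrite /= /partner kodd; lia.
have [kd1 | kd1] := ltnP k.+1 d.
  have kb : (k./2 < d./2)%N by lia.
  by exists (Ordinal kb); left; apply: val_inj => /=; lia.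
(* Here d is odd and [k] is the last coordinate, paired with 0; that 0 lies in a plane uses [hd]. *)
have kb : (0 < d./2)%N by lia.
exists (Ordinal kb); right; apply: val_inj.
by rewrite /= /partner (negPf kodd) ltnNge kd1.
Qed.

Lemma helly_eigenvector_ge k :
  helly_eigenvector 'cV[K]_d k -> ((3 * d) %/ 2 <= k)%N.
Proof.
move=> hk; rewrite leqNgt; apply/negP => ltk.
have [J leJ | w] := hk _ extremal_op; last exact: extremal_op_no_common.
have [i iJ] : exists i, i \notin J.
  apply/existsP; rewrite -negb_forall; apply/negP => /forallP allJ.
  have : (#|{: 'I_d + 'I_d./2}| <= #|J|)%N by apply/subset_leq_card/subsetP.
  rewrite card_sum !card_ord; lia.
exists (extremal_vec i); split=> [|j Jj]; first exact: extremal_vec_neq0.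
by apply: extremal_vecP; apply: contraNneq iJ => ->.
Qed.

End LowerBound.

Theorem theorem2 (K : fieldType) (d : nat) (hd : (2 <= d)%N) :
  HE 'cV[K]_d ((3 * d) %/ 2)%N.
Proof.
split; first lia.
  (* The dimension of ['cV[K]_d] unfolds to [d * 1]. *)
  by rewrite -[d in (3 * d)%N]muln1; apply: helly_eigenvector_dim.
by move=> k _; apply: helly_eigenvector_ge.
Qed.
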